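(* Fix $\ell$, a partition $\mu$ with at most $\ell$ parts, and $\pi_1,\dots,\pi_\ell>0$. For every partition $\lambda$ with at most $\ell$ parts and $t>0$, $\frac{d}{dt}\mathsf{P}_C(\mathbf{G}(t)=\lambda\mid\mathbf{G}(0)=\mu)=-\sum_{s=1}^{\ell}\pi_s\,\mathsf{P}_C(\mathbf{G}(t)=\lambda\mid\mathbf{G}(0)=\mu)+\sum_{s=1}^{\ell}\pi_s\,\mathsf{P}_C(\mathbf{G}(t)=\lambda-\epsilon_s\mid\mathbf{G}(0)=\mu)$, and, for every such $\lambda$ and $s$ with $\lambda_s=\lambda_{s+1}$, $\pi_s\,\mathsf{P}_C(\mathbf{G}(t)=\lambda-\epsilon_s\mid\mathbf{G}(0)=\mu)=\pi_{s+1}\,\mathsf{P}_C(\mathbf{G}(t)=\lambda\mid\mathbf{G}(0)=\mu)$.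
   Context: $\epsilon_s$ is the $s$-th standard basis vector of $\mathbb{Z}^\ell$. For $\beta_k=\pi_{k+1}$, $t>0$ and any $\lambda\in\mathbb{Z}^\ell$ define $\mathsf{P}_C(\mathbf{G}(t)=\lambda\mid\mathbf{G}(0)=\mu):=\prod_{j=1}^{\ell}e^{-\pi_jt}\prod_j\pi_j^{\lambda_j-\mu_j}\det\Bigl[\oint_{\widetilde{\gamma}_r}\frac{\prod_{k=1}^{i-1}(1-\beta_kw^{-1})\,e^{tw}}{\prod_{k=1}^{j-1}(1-\beta_kw^{-1})\,w^{(\lambda_i-i)-(\mu_j-j)}}\frac{dw}{2\pi\mathbf{i}w}\Bigr]_{i,j=1}^{\ell}$, with $\widetilde{\gamma}_r$ the positively oriented circle centered at $0$ of radius $r>|\beta_k|$ for all $k$. For partitions $\lambda$ this equals the continuous time limit of the Case C process: $\ell$ particles on $\mathbb{Z}_{\ge0}$ with positions $G(1,i)\ge\dots\ge G(\ell,i)$, updated at each discrete step $i$ in order $\ell,\dots,1$ by $G(j,i)=\min(G(j,i-1)+w_{ji},G(j-1,i-1))$ ($G(0,i)=\infty$) with independent $\mathsf{P}(w_{ji}=k)=(1-\pi_jx_i)(\pi_jx_i)^k$, and the limit $\lim_{p\to0^+}$ of the $\lfloor t/p\rfloor$-step transition probability with all $x_i=p$. For non-partition sequences (such as $\lambda-\epsilon_s$ above) the symbol denotes the determinant expression. *)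

(* Defs.v *)
From HB Require Import structures.
From mathcomp Require Export all_boot all_order all_algebra.
From mathcomp Require Export all_classical all_reals all_analysis.
From mathcomp Require Export complex.
Export Order.TTheory GRing.Theory Num.Theory.
Export numFieldNormedType.Exports.

Set Implicit Arguments.
Unset Strict Implicit.
Unset Printing Implicit Defensive.

Local Open Scope classical_set_scope.
Local Open Scope ring_scope.
Local Open Scope complex_scope.

Definition expC (R : realType) (z : R[i]) : R[i] :=
  (expR (complex.Re z) * cos (complex.Im z)) +i*
  (expR (complex.Re z) * sin (complex.Im z)).

Definition cintegral (R : realType) (a b : R) (f : R -> R[i]) : R[i] :=
  (\int[@lebesgue_measure R]_(x in `[a, b]) complex.Re (f x)) +i*
  (\int[@lebesgue_measure R]_(x in `[a, b]) complex.Im (f x)).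

Definition circle (R : realType) (r theta : R) : R[i] :=
  r%:C * expC ('i%C * theta%:C).

(* \oint f(w) dw along w = r e^{i theta}, for which dw = i w dtheta. *)
Definition circle_integral (R : realType) (r : R) (f : R[i] -> R[i]) : R[i] :=
  cintegral 0 (2 * pi)
    (fun theta => f (circle r theta) * ('i%C * circle r theta)).

Definition is_cderive (R : realType) (f : R -> R[i]) (t : R) (df : R[i]) :
    Prop :=
  is_derive t 1 (fun u => complex.Re (f u)) (complex.Re df) /\
  is_derive t 1 (fun u => complex.Im (f u)) (complex.Im df).

Definition is_part (l : nat) (lam : 'rV[int]_l) : Prop :=
  (forall i, 0 <= lam 0 i) /\
  (forall i j : 'I_l, (i <= j)%N -> lam 0 j <= lam 0 i).

(* All indices are 0-based.  Since beta_k = pi_{k+1} in 1-based indexing,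
   beta_k (1 <= k < l) is the 0-based entry p 0 k, and the 1-based range
   1 <= k <= i - 1 is 0 < k <= i once i is 0-based. *)
Definition beta_prod (R : realType) (l : nat) (p : 'rV[R]_l) (i : 'I_l)
    (w : R[i]) : R[i] :=
  \prod_(k < l | (0 < k <= i)%N) (1 - (p 0 k)%:C * w^-1).

(* The exponent (lam_i - i) - (mu_j - j) is invariant under the shift from
   1-based to 0-based indices. *)
Definition PC_kernel (R : realType) (l : nat) (p : 'rV[R]_l)
    (lam mu : 'rV[int]_l) (t : R) (i j : 'I_l) (w : R[i]) : R[i] :=
  (beta_prod p i w * expC (t%:C * w)) /
  (beta_prod p j w * w ^ ((lam 0 i - i%:Z) - (mu 0 j - j%:Z))).

(* P_C(G(t) = lam | G(0) = mu), computed on the circle of radius r. *)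
Definition PC (R : realType) (l : nat) (p : 'rV[R]_l) (r : R)
    (mu lam : 'rV[int]_l) (t : R) : R[i] :=
  ((\prod_(j < l) expR (- p 0 j * t)) *
   (\prod_(j < l) p 0 j ^ (lam 0 j - mu 0 j)))%:C *
  \det (\matrix_(i < l, j < l)
          circle_integral r
            (fun w => PC_kernel p lam mu t i j w / (2 * pi%:C * 'i%C * w))).

(* Main.v *)
Require Import Defs.
From mathcomp Require Import perm ring lra.
(** In row i, the time variable enters the determinant only through e^{tw}, so
    d/dt inserts a factor w into the integrand, which is the shift
    lam_i -> lam_i - 1.  Differentiating the determinant row by row gives the
    sum over s, the factor pi_s accounting for the change in
    prod_j pi_j^{lam_j - mu_j}.  If lam_s = lam_{s+1}, then
    w = beta_s + (1 - beta_s / w) w shows that row s of the matrix of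
    lam - eps_s is beta_s times row s of the matrix of lam plus its row s+1,
    and the second summand does not contribute to the determinant. *)

Set Implicit Arguments.
Unset Strict Implicit.
Unset Printing Implicit Defensive.

Local Open Scope classical_set_scope.
Local Open Scope ring_scope.
Local Open Scope complex_scope.

(** * Real and imaginary parts of complex arithmetic *)

Section ComplexParts.
Variable R : realType.
Implicit Types x y z : R[i].

Lemma complexP x y :
  complex.Re x = complex.Re y -> complex.Im x = complex.Im y -> x = y.
Proof. by case: x y => [a b] [c d] /= -> ->. Qed.

Lemma ReD x y : complex.Re (x + y) = complex.Re x + complex.Re y.
Proof. by case: x y => [a b] [c d]. Qed.

Lemma ImD x y : complex.Im (x + y) = complex.Im x + complex.Im y.
Proof. by case: x y => [a b] [c d]. Qed.

Lemma ReM x y : complex.Re (x * y) =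
  complex.Re x * complex.Re y - complex.Im x * complex.Im y.
Proof. by case: x y => [a b] [c d]. Qed.

Lemma ImM x y : complex.Im (x * y) =
  complex.Re x * complex.Im y + complex.Im x * complex.Re y.
Proof. by case: x y => [a b] [c d]. Qed.

Lemma ReV x : complex.Re x^-1 =
  complex.Re x / (complex.Re x ^+ 2 + complex.Im x ^+ 2).
Proof. by case: x. Qed.

Lemma ImV x : complex.Im x^-1 =
  - (complex.Im x / (complex.Re x ^+ 2 + complex.Im x ^+ 2)).
Proof. by case: x. Qed.

(** Lets a statement proved for real parts be transferred to imaginary parts, by multiplying the
    integrand by -i. *)
Lemma Im_ReMi x : complex.Im x = complex.Re (- 'i%C * x).
Proof. by rewrite ReM /= oppr0 mul0r sub0r mulN1r opprK. Qed.

End ComplexParts.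

(** * Continuity of complex-valued functions and linearity of [cintegral] *)

Section ComplexContinuity.
Variables (R : realType).
Implicit Types (f g : R -> R[i]) (z : R[i]).

(** Componentwise, because [cintegral] integrates the two real components separately. *)
Definition ccontinuous f :=
  continuous (fun x => complex.Re (f x)) /\
  continuous (fun x => complex.Im (f x)).

Lemma ccontinuous_cst z : ccontinuous (fun=> z).
Proof. by split=> x; exact: cvg_cst. Qed.

Lemma ccontinuousD f g :
  ccontinuous f -> ccontinuous g -> ccontinuous (fun x => f x + g x).
Proof.
move=> [f1 f2] [g1 g2]; split=> x.
- by under eq_fun do rewrite ReD; apply: cvgD; [exact: f1|exact: g1].
- by under eq_fun do rewrite ImD; apply: cvgD; [exact: f2|exact: g2].
Qed.

Lemma ccontinuousM f g :
  ccontinuous f -> ccontinuous g -> ccontinuous (fun x => f x * g x).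
Proof.
move=> [f1 f2] [g1 g2]; split=> x.
- under eq_fun do rewrite ReM.
  by apply: cvgB; apply: cvgM; [exact: f1|exact: g1|exact: f2|exact: g2].
- under eq_fun do rewrite ImM.
  by apply: cvgD; apply: cvgM; [exact: f1|exact: g2|exact: f2|exact: g1].
Qed.

Lemma ccontinuousV f :
  (forall x, f x != 0) -> ccontinuous f -> ccontinuous (fun x => (f x)^-1).
Proof.
move=> f0 [f1 f2].
(* The squared modulus, which is the common denominator of both parts of the inverse, does not
   vanish. *)
have n0 x : complex.Re (f x) ^+ 2 + complex.Im (f x) ^+ 2 != 0.
  rewrite paddr_eq0 ?sqr_ge0// !sqrf_eq0.
  by have := f0 x; rewrite eq_complex.
have cn (x : R) : (complex.Re (f y) ^+ 2 + complex.Im (f y) ^+ 2)^-1 @[y --> x]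
    --> (complex.Re (f x) ^+ 2 + complex.Im (f x) ^+ 2)^-1.
  apply: cvgV => //; under eq_fun do rewrite !expr2.
  by rewrite !expr2; apply: cvgD; apply: cvgM; (exact: f1 || exact: f2).
split=> x.
- under eq_fun do rewrite ReV.
  by apply: cvgM; [exact: f1|exact: cn].
- under eq_fun do rewrite ImV.
  by apply: cvgN; apply: cvgM; [exact: f2|exact: cn].
Qed.

Lemma ccontinuous_prod (I : Type) (s : seq I) (P : pred I)
    (F : I -> R -> R[i]) :
  (forall i, P i -> ccontinuous (F i)) ->
  ccontinuous (fun x => \prod_(i <- s | P i) F i x).
Proof.
move=> cF; elim: s => [|i s IH].
  by under eq_fun do rewrite big_nil; exact: ccontinuous_cst.
under eq_fun do rewrite big_cons.
by case Pi: (P i) => //; apply: ccontinuousM => //; exact: cF.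
Qed.

Lemma ccontinuousXz f (n : int) :
  (forall x, f x != 0) -> ccontinuous f -> ccontinuous (fun x => f x ^ n).
Proof.
move=> f0 cf.
have cX m : ccontinuous (fun x => f x ^+ m).
  elim: m => [|m IH]; first exact: ccontinuous_cst.
  under eq_fun do rewrite exprS.
  exact: ccontinuousM.
case: n => m; first exact: cX.
(* Here the exponent [Negz m] is -(m + 1), so the function is the inverse of the power [m.+1]. *)
by apply: ccontinuousV => // x; rewrite expf_neq0.
Qed.

Lemma ccontinuous_expC f : ccontinuous f -> ccontinuous (fun x => expC (f x)).
Proof.
move=> [f1 f2].
by split=> x; apply: cvgM; apply: continuous_cvg;
  (exact: continuous_expR || exact: continuous_cos || exact: continuous_sin ||
   exact: f1 || exact: f2).
Qed.

Lemma ccontinuous_circle (r : R) : ccontinuous (circle r).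
Proof.
apply: ccontinuousM; first exact: ccontinuous_cst.
apply: ccontinuous_expC; apply: ccontinuousM; first exact: ccontinuous_cst.
by split=> x; [exact: cvg_id|exact: cvg_cst].
Qed.

Lemma continuous_itv_integrable (a b : R) (f : R -> R) : continuous f ->
  (@lebesgue_measure R).-integrable `[a, b] (EFin \o f).
Proof.
move=> cf; apply: continuous_compact_integrable.
  exact: segment_compact.
exact: continuous_subspaceT.
Qed.

Lemma cintegralD (a b : R) f g : ccontinuous f -> ccontinuous g ->
  cintegral a b (fun x => f x + g x) = cintegral a b f + cintegral a b g.
Proof.
move=> [f1 f2] [g1 g2]; apply: complexP; rewrite ?ReD ?ImD /=.
- under eq_Rintegral do rewrite ReD.
  by rewrite RintegralD//; exact: continuous_itv_integrable.
- under eq_Rintegral do rewrite ImD.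
  by rewrite RintegralD//; exact: continuous_itv_integrable.
Qed.

Lemma cintegralZl (a b : R) (k : R[i]) f : ccontinuous f ->
  cintegral a b (fun x => k * f x) = k * cintegral a b f.
Proof.
move=> [f1 f2].
have iZ (c : R) h : continuous h ->
    (@lebesgue_measure R).-integrable `[a, b] (EFin \o (fun x => c * h x)).
  move=> ch; apply: continuous_itv_integrable => x.
  by apply: cvgM; [exact: cvg_cst|exact: ch].
apply: complexP; rewrite ?ReM ?ImM /=.
- under eq_Rintegral do rewrite ReM.
  rewrite RintegralB//; [|exact: iZ|exact: iZ].
  by rewrite !RintegralZl//; exact: continuous_itv_integrable.
- under eq_Rintegral do rewrite ImM.
  rewrite RintegralD//; [|exact: iZ|exact: iZ].
  by rewrite !RintegralZl//; exact: continuous_itv_integrable.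
Qed.

End ComplexContinuity.


(** * Derivatives in t of products, determinants and integrals *)

Section ComplexDerivative.
Variable R : realType.
Implicit Types (f g : R -> R[i]) (t : R).

Lemma is_cderive_cst t (z : R[i]) : is_cderive (fun=> z) t 0.
Proof. by split; exact: is_derive_cst. Qed.

Lemma is_cderiveD f g t df dg : is_cderive f t df -> is_cderive g t dg ->
  is_cderive (fun u => f u + g u) t (df + dg).
Proof.
move=> [f1 f2] [g1 g2]; split.
- by under eq_fun do rewrite ReD; rewrite ReD; exact: is_deriveD.
- by under eq_fun do rewrite ImD; rewrite ImD; exact: is_deriveD.
Qed.

Lemma is_cderiveM f g t df dg : is_cderive f t df -> is_cderive g t dg ->
  is_cderive (fun u => f u * g u) t (df * g t + f t * dg).
Proof.
move=> [f1 f2] [g1 g2]; split.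
- under eq_fun do rewrite ReM.
  by apply: is_derive_eq; rewrite ReD !ReM /GRing.scale /=; ring.
- under eq_fun do rewrite ImM.
  by apply: is_derive_eq; rewrite ImD !ImM /GRing.scale /=; ring.
Qed.

Lemma is_cderive_sum (I : Type) (s : seq I) (F : I -> R -> R[i])
    (dF : I -> R[i]) t :
  (forall i, is_cderive (F i) t (dF i)) ->
  is_cderive (fun u => \sum_(i <- s) F i u) t (\sum_(i <- s) dF i).
Proof.
move=> hF; elim: s => [|i s IH].
  by under eq_fun do rewrite big_nil; rewrite big_nil; exact: is_cderive_cst.
under eq_fun do rewrite big_cons.
by rewrite big_cons; apply: is_cderiveD.
Qed.

(** Leibniz rule with k the differentiated factor; [uniq s] makes the test [i == k] select a single
    occurrence. The conditional form is the one that replacing a row of a matrix produces. *)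
Lemma is_cderive_prod (I : eqType) (s : seq I) (F : I -> R -> R[i])
    (dF : I -> R[i]) t :
  uniq s -> (forall i, is_cderive (F i) t (dF i)) ->
  is_cderive (fun u => \prod_(i <- s) F i u) t
    (\sum_(k <- s) \prod_(i <- s) (if i == k then dF i else F i t)).
Proof.
move=> + hF; elim: s => [_|i s IH /= /andP[iNs us]].
  by under eq_fun do rewrite big_nil; rewrite big_nil; exact: is_cderive_cst.
under eq_fun do rewrite big_cons.
rewrite big_cons big_cons eqxx.
(* As [i] does not occur in the tail, the terms with k in the tail leave the head factor untouched,
   and the term k = i leaves the tail untouched. *)
under [X in _ + X]eq_big_seq => k ks.
  rewrite big_cons; have -> : (i == k) = false.
    by apply: contraNF iNs => /eqP ->.
  over.
rewrite -big_distrr /=.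
rewrite (_ : \prod_(j <- s) (if j == i then dF j else F j t) =
             \prod_(j <- s) F j t).
  by apply: is_cderiveM => //; exact: IH.
by apply: eq_big_seq => j js; case: eqP => // ji; rewrite -ji js in iNs.
Qed.

(** In the permutation expansion every term has exactly one factor from each row, so the product
    rule, summed over permutations, differentiates one row at a time. *)
Lemma is_cderive_det (n : nat) (A : R -> 'M[R[i]]_n) (dA : 'M[R[i]]_n) t :
  (forall i j, is_cderive (fun u => A u i j) t (dA i j)) ->
  is_cderive (fun u => \det (A u)) t
    (\sum_(k < n) \det (\matrix_(i, j) (if i == k then dA i j else A t i j))).
Proof.
move=> hA; rewrite /determinant.
rewrite exchange_big /=; apply: is_cderive_sum => s.
rewrite -big_distrr /=.
under eq_bigr => k _ do under eq_bigr => i _ do rewrite mxE.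
(* The sign of the permutation is a constant factor; its zero derivative is inserted to match the
   product rule. *)
rewrite -[X in is_cderive _ _ X]add0r.
rewrite -[X in X + _](mul0r (\prod_i A t i (s i))).
apply: is_cderiveM; first exact: is_cderive_cst.
by apply: is_cderive_prod => //; exact: index_enum_uniq.
Qed.

Lemma is_derive_mulr_id (a t : R) : is_derive t 1 (fun u => u * a) a.
Proof. by apply: is_derive_eq; rewrite /GRing.scale /= mulr0 add0r mulr1. Qed.

Lemma is_derive_expRM (a t : R) :
  is_derive t 1 (fun u => expR (u * a)) (a * expR (t * a)).
Proof.
rewrite mulrC; apply: (@is_derive1_comp _ expR (fun u => u * a)).
exact: is_derive_mulr_id.
Qed.

Lemma is_cderive_expC t (z : R[i]) :
  is_cderive (fun u => expC (u%:C * z)) t (z * expC (t%:C * z)).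
Proof.
have he := is_derive_expRM (complex.Re z) t.
have hc : is_derive t 1 (fun u => cos (u * complex.Im z))
    (- sin (t * complex.Im z) * complex.Im z).
  apply: (@is_derive1_comp _ cos (fun u => u * complex.Im z)).
  exact: is_derive_mulr_id.
have hs : is_derive t 1 (fun u => sin (u * complex.Im z))
    (cos (t * complex.Im z) * complex.Im z).
  apply: (@is_derive1_comp _ sin (fun u => u * complex.Im z)).
  exact: is_derive_mulr_id.
have zE u : (complex.Re (u%:C * z) = u * complex.Re z) *
            (complex.Im (u%:C * z) = u * complex.Im z).
  by rewrite ReM ImM /= !mul0r subr0 addr0.
rewrite /expC; split; under eq_fun do rewrite /= !zE.
- by apply: is_derive_eq; rewrite ReM /= !zE /GRing.scale /=; ring.
- by apply: is_derive_eq; rewrite ImM /= !zE /GRing.scale /=; ring.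
Qed.

Lemma is_cderive_exp_kernel (h z : R[i]) t :
  is_cderive (fun u => h * expC (u%:C * z)) t (h * z * expC (t%:C * z)).
Proof.
rewrite -[X in is_cderive _ _ X]add0r -[X in X + _](mul0r (expC (t%:C * z))).
rewrite -mulrA; apply: is_cderiveM; first exact: is_cderive_cst.
exact: is_cderive_expC.
Qed.

(** The right-hand side depends on x only through the bound M; this uniformity supplies the
    dominating function for differentiation under the integral. *)
Lemma normr_Re_expC (h z : R[i]) (x M : R) : `|x| <= M ->
  `|complex.Re (h * expC (x%:C * z))| <=
  (`|complex.Re h| + `|complex.Im h|) * expR (M * `|complex.Re z|).
Proof.
move=> xM; rewrite ReM /= mulrCA [complex.Im h * _]mulrCA -mulrBr normrM.
rewrite [leRHS]mulrC; apply: ler_pM => //.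
  rewrite ger0_norm ?expR_ge0// ler_expR ReM /= mul0r subr0.
  by apply: le_trans (ler_norm _) _; rewrite normrM ler_wpM2r.
apply: le_trans (ler_normB _ _) _; rewrite !normrM.
by apply: lerD; apply: ler_piMr;
  rewrite // ler_norml ?cos_geN1 ?cos_le1 ?sin_geN1 ?sin_le1.
Qed.

(** Dominated differentiation under the integral sign, with the parameter confined to the unit
    neighbourhood of t. *)
Lemma is_derive_Re_integral (a b t : R) (h c : R -> R[i]) :
  ccontinuous h -> ccontinuous c ->
  is_derive t 1
    (fun u => \int[@lebesgue_measure R]_(x in `[a, b])
                 complex.Re (h x * expC (u%:C * c x)))
    (\int[@lebesgue_measure R]_(x in `[a, b])
       complex.Re (h x * c x * expC (t%:C * c x))).
Proof.
move=> ch cc.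
pose f u x := complex.Re (h x * expC (u%:C * c x)).
have df (u x : R) : is_derive u 1 (f ^~ x)
    (complex.Re (h x * c x * expC (u%:C * c x))).
  by have [] := is_cderive_exp_kernel (h x) (c x) u.
have d1f (u x : R) : partial1of2 f u x =
    complex.Re (h x * c x * expC (u%:C * c x)).
  by rewrite partial1of2E; have [_ ->] := df u x.
have cf u : continuous (f u).
  apply: (proj1 (_ : ccontinuous _)).
  apply: ccontinuousM => //; apply: ccontinuous_expC.
  by apply: ccontinuousM => //; exact: ccontinuous_cst.
(* Dominating function: [normr_Re_expC] for h c in place of h, with M = |t| + 1, which bounds |u|
   for u in ]t - 1, t + 1[. *)
pose G x := (`|complex.Re (h x * c x)| + `|complex.Im (h x * c x)|) *
            expR ((`|t| + 1) * `|complex.Re (c x)|).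
have [hc1 hc2] : ccontinuous (fun x => h x * c x) by exact: ccontinuousM.
have It : `]t - 1, t + 1[%classic t by rewrite /= in_itv /=; lra.
have intf (u : R) : `]t - 1, t + 1[%classic u ->
    (@lebesgue_measure R).-integrable `[a, b] (EFin \o f u).
  by move=> _; exact: continuous_itv_integrable.
have G0 x : 0 <= G x by rewrite mulr_ge0 ?addr_ge0 ?expR_ge0.
have iG : (@lebesgue_measure R).-integrable `[a, b] (EFin \o G).
  apply: continuous_itv_integrable => x; apply: cvgM.
    by apply: cvgD; apply: cvg_norm; [exact: hc1|exact: hc2].
  apply: continuous_cvg; first exact: continuous_expR.
  by apply: cvgM; [exact: cvg_cst|apply: cvg_norm; exact: cc.1].
have Gub (u x : R) : `]t - 1, t + 1[%classic u -> `[a, b]%classic x ->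
    `|partial1of2 f u x| <= G x.
  rewrite /= in_itv /= => /andP[tu ut] _; rewrite d1f; apply: normr_Re_expC.
  have t1 := ler_norm t; have := ler_norm (- t); rewrite normrN => t2.
  by rewrite ler_norml; apply/andP; split; lra.
have dfI (u x : R) : `]t - 1, t + 1[%classic u -> `[a, b]%classic x ->
    derivable (f ^~ x) u 1.
  by move=> _ _; exact: ex_derive.
have mI : measurable (`[a, b]%classic : set (measurableTypeR R)).
  exact: measurable_itv.
apply: DeriveDef.
  exact: (derivable_under_integral mI It intf dfI G0 iG Gub).
rewrite -derive1E (differentiation_under_integral mI It intf dfI G0 iG Gub).
by apply: eq_Rintegral => x _; rewrite -d1f.
Qed.

Lemma is_cderive_cintegral (a b t : R) (h c : R -> R[i]) :
  ccontinuous h -> ccontinuous c ->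
  is_cderive (fun u => cintegral a b (fun x => h x * expC (u%:C * c x))) t
    (cintegral a b (fun x => h x * c x * expC (t%:C * c x))).
Proof.
move=> ch cc; split=> /=; first exact: is_derive_Re_integral.
(* The imaginary part is the real part with [h] replaced by -i h. *)
under eq_fun do under eq_Rintegral do rewrite Im_ReMi mulrA.
under eq_Rintegral do rewrite Im_ReMi !mulrA.
apply: (@is_derive_Re_integral a b t (fun x => - 'i%C * h x)) => //.
by apply: ccontinuousM => //; exact: ccontinuous_cst.
Qed.

End ComplexDerivative.

(** * A row operation on determinants *)

Lemma det_add_row (F : comNzRingType) (n : nat) (A B : 'M[F]_n) (s s' : 'I_n)
    (a : F) :
  s != s' -> (forall j, A s j = a * B s j + B s' j) ->
  (forall i j, i != s -> A i j = B i j) -> \det A = a * \det B.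
Proof.
move=> ss' As Ai.
have lift_s i : lift s i != s by rewrite eq_sym neq_lift.
(* [C] is [B] with row s overwritten by row s'; its two equal rows make its determinant zero, and
   linearity in row s then gives the claim. *)
pose C := \matrix_(i, j) B (if i == s then s' else i) j.
have detC : \det C = 0.
  apply: (determinant_alternate ss') => j.
  by rewrite !mxE eqxx (eq_sym s') (negbTE ss').
rewrite (@determinant_multilinear _ _ _ B C s a 1).
- by rewrite detC mulr0 addr0.
- by apply/rowP => j; rewrite !mxE As eqxx mul1r.
- by apply/matrixP => i j; rewrite !mxE Ai.
- by apply/matrixP => i j; rewrite !mxE Ai ?(negbTE (lift_s i)).
Qed.

(** * The contour avoids the origin *)

Section Circle.
Variable R : realType.
Implicit Types r theta : R.

Lemma norm_realC (x : R) : `|x%:C| = `|x|%:C.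
Proof. by rewrite normc_def /= expr0n /= addr0 sqrtr_sqr. Qed.

Lemma norm_circle r theta : 0 < r -> `|circle r theta| = r%:C.
Proof.
move=> r0; rewrite /circle normrM norm_realC (gtr0_norm r0).
suff -> : `|expC ('i%C * theta%:C)| = 1 by rewrite mulr1.
rewrite normc_def /expC ReM ImM /= !mul0r !mul1r subr0 add0r.
by rewrite expR0 !mul1r cos2Dsin2 sqrtr1.
Qed.

Lemma circle_neq0 r theta : 0 < r -> circle r theta != 0.
Proof.
move=> r0; rewrite -normr_eq0 norm_circle// eq_complex /= negb_and.
by rewrite gt_eqF.
Qed.

End Circle.

(** * Matrix entries as contour integrals: time derivative and boundary relation *)

Section Kernel.
Variables (R : realType) (l : nat) (p : 'rV[R]_l) (r : R).
Hypothesis r_gt0 : 0 < r.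
Hypothesis p_lt_r : forall k : 'I_l, (0 < k)%N -> `|p 0 k| < r.

(** A factor 1 - p_k / w vanishes only at w = p_k, which lies strictly inside the circle. *)
Lemma beta_prod_circle_neq0 (i : 'I_l) (theta : R) :
  beta_prod p i (circle r theta) != 0.
Proof.
apply/prodf_neq0 => k /andP[k0 _].
have w0 := circle_neq0 theta r_gt0.
apply/eqP => /(congr1 (fun z => z * circle r theta)) /eqP.
rewrite mulrBl mul1r mul0r mulfVK// subr_eq0 => /eqP /(congr1 Num.norm).
rewrite norm_circle// norm_realC => /complexI rE.
by have := p_lt_r k0; rewrite -rE ltxx.
Qed.

Lemma beta_prodS (s s' : 'I_l) w : s' = s.+1 :> nat ->
  beta_prod p s' w = (1 - (p 0 s')%:C * w^-1) * beta_prod p s w.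
Proof.
move=> ss'; rewrite /beta_prod (bigD1 s') /=; last by rewrite ss' /=.
congr (_ * _); apply: eq_bigl => k.
rewrite -andbA; congr (_ && _).
by rewrite andbC -val_eqE /= -ltn_neqAle ss' ltnS.
Qed.

(* The theta-integrand of the contour integral for the exponent n, without
   its factor e^{tw}. *)
Definition PC_coef (n : int) (i j : 'I_l) (w : R[i]) : R[i] :=
  beta_prod p i w / (beta_prod p j w * w ^ n) / (2 * pi%:C * 'i%C * w) *
  ('i%C * w).

(** The exponent [n] is kept apart from the row index [i], so that the time derivative and the shift
    of lam both become n -> n - 1 with the beta products fixed. *)
Definition PC_entry (n : int) (i j : 'I_l) (t : R) : R[i] :=
  cintegral 0 (2 * pi) (fun theta =>
    PC_coef n i j (circle r theta) * expC (t%:C * circle r theta)).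

Lemma circle_integral_PC_kernel (lam mu : 'rV[int]_l) (t : R) (i j : 'I_l) :
  circle_integral r
    (fun w => PC_kernel p lam mu t i j w / (2 * pi%:C * 'i%C * w)) =
  PC_entry ((lam 0 i - i%:Z) - (mu 0 j - j%:Z)) i j t.
Proof.
rewrite /circle_integral /PC_entry; congr cintegral; apply/funext => theta.
by rewrite /PC_kernel /PC_coef; ring.
Qed.

Lemma ccontinuous_PC_coef n i j :
  ccontinuous (fun theta => PC_coef n i j (circle r theta)).
Proof.
have cw := ccontinuous_circle r.
have w0 (x : R) := circle_neq0 x r_gt0.
have cB k : ccontinuous (fun x => beta_prod p k (circle r x)).
  apply: ccontinuous_prod => m _.
  apply: ccontinuousD; first exact: ccontinuous_cst.
  under eq_fun do rewrite -mulNr.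
  by apply: ccontinuousM; [exact: ccontinuous_cst|exact: ccontinuousV].
have ci : 2 * pi%:C * 'i%C != 0 :> R[i].
  rewrite !mulf_neq0// eq_complex /= ?oner_eq0 ?andbF//.
  by rewrite gt_eqF ?pi_gt0.
apply: ccontinuousM; last by apply: ccontinuousM => //; exact: ccontinuous_cst.
apply: ccontinuousM.
  apply: ccontinuousM => //; apply: ccontinuousV.
    by move=> x; rewrite mulf_neq0 ?beta_prod_circle_neq0 ?expfz_neq0.
  by apply: ccontinuousM => //; exact: ccontinuousXz.
apply: ccontinuousV; first by move=> x; rewrite mulf_neq0.
by apply: ccontinuousM => //; exact: ccontinuous_cst.
Qed.

Lemma PC_coefB1 n i j w : w != 0 -> PC_coef (n - 1) i j w = PC_coef n i j w * w.
Proof.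
move=> w0; rewrite /PC_coef expfzDr// exprN1 !invfM invrK.
by ring.
Qed.

Lemma is_cderive_PC_entry n i j t :
  is_cderive (PC_entry n i j) t (PC_entry (n - 1) i j t).
Proof.
rewrite /PC_entry.
under [in X in is_cderive _ _ X]eq_fun => x.
  rewrite PC_coefB1 ?circle_neq0//; over.
apply: is_cderive_cintegral; first exact: ccontinuous_PC_coef.
exact: ccontinuous_circle.
Qed.

(** The identity w = beta + (1 - beta / w) w, with beta = p_{s'}, holds under the integral; the
    factor 1 - beta / w turns the beta product of row s into that of row s'. *)
Lemma PC_entry_boundary n (s s' j : 'I_l) t : s' = s.+1 :> nat ->
  PC_entry (n - 1) s j t =
  (p 0 s')%:C * PC_entry n s j t + PC_entry (n - 1) s' j t.
Proof.
move=> ss'; rewrite /PC_entry.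
have cE m i : ccontinuous (fun theta =>
    PC_coef m i j (circle r theta) * expC (t%:C * circle r theta)).
  apply: ccontinuousM; first exact: ccontinuous_PC_coef.
  apply: ccontinuous_expC; apply: ccontinuousM; first exact: ccontinuous_cst.
  exact: ccontinuous_circle.
rewrite -cintegralZl// -cintegralD//; last first.
  by apply: ccontinuousM => //; exact: ccontinuous_cst.
congr cintegral; apply/funext => x.
have w0 := circle_neq0 x r_gt0.
rewrite mulrA -mulrDl; congr (_ * _).
rewrite !PC_coefB1// /PC_coef (beta_prodS _ ss').
set w := circle r x in w0 *; set B := beta_prod p s w.
(* The denominators [D] and [E] are common to all three terms, so the only cancellation required is
   w^-1 * w = 1. *)
set D := (_ * w ^ n)^-1; set E := (_ * w)^-1.
have -> : (1 - (p 0 s')%:C / w) * B * D * E * ('i%C * w) * w =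
    B * D * E * ('i%C * w) * w -
    (p 0 s')%:C * (B * D * E * ('i%C * w)) * (w^-1 * w).
  by ring.
by rewrite mulVf// mulr1; ring.
Qed.

End Kernel.

(** * The evolution equation and the boundary condition *)

Section Generator.
Variables (R : realType) (l : nat) (p : 'rV[R]_l) (r : R) (mu : 'rV[int]_l).
Implicit Types (lam : 'rV[int]_l) (t : R) (s : 'I_l).
Hypothesis p_gt0 : forall j, 0 < p 0 j.
Hypothesis r_gt0 : 0 < r.
Hypothesis p_lt_r : forall k : 'I_l, (0 < k)%N -> `|p 0 k| < r.

Definition PC_mx lam t : 'M[R[i]]_l :=
  \matrix_(i, j) PC_entry p r ((lam 0 i - i%:Z) - (mu 0 j - j%:Z)) i j t.

(** The scalar prefactor of [PC], with the exponentials merged into one so that t occurs in a single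
    factor. *)
Definition PC_weight lam t : R :=
  expR (t * - \sum_(j < l) p 0 j) * \prod_(j < l) p 0 j ^ (lam 0 j - mu 0 j).

Lemma PC_E lam t : PC p r mu lam t = (PC_weight lam t)%:C * \det (PC_mx lam t).
Proof.
rewrite /PC /PC_weight.
have -> : \prod_(j < l) expR (- p 0 j * t) = expR (t * - \sum_(j < l) p 0 j).
  rewrite -expR_sum; congr expR; rewrite mulrN mulr_sumr -sumrN.
  by apply: eq_bigr => j _; rewrite mulNr mulrC.
congr (_ * \det _); apply/matrixP => i j.
by rewrite !mxE circle_integral_PC_kernel.
Qed.

Lemma PC_weightB lam s t :
  p 0 s * PC_weight (lam - delta_mx 0 s) t = PC_weight lam t.
Proof.
rewrite /PC_weight mulrCA; congr (_ * _).
(* Only the factor at s changes: p_s times p_s^(m - 1) is p_s^m, valid for negative m as well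
   because p_s is nonzero. *)
rewrite (bigD1 s)//= [RHS](bigD1 s)//= mulrA; congr (_ * _).
  rewrite !mxE !eqxx /= -[X in X * _]expr1z -expfzDr ?gt_eqF//.
  by congr (_ ^ _); ring.
apply: eq_bigr => k ks; rewrite !mxE eqxx /= (negbTE ks) /=.
by congr (_ ^ _); ring.
Qed.

(** Absorbing p_s into the prefactor gives the shifted determinant the weight of [lam] itself,
    independent of s. *)
Lemma PC_subdelta lam s t :
  (p 0 s)%:C * PC p r mu (lam - delta_mx 0 s) t =
  (PC_weight lam t)%:C * \det (PC_mx (lam - delta_mx 0 s) t).
Proof. by rewrite PC_E mulrA -rmorphM /= PC_weightB. Qed.

Lemma PC_mx_subdelta lam s t i j :
  PC_mx (lam - delta_mx 0 s) t i j =
  if i == s then PC_entry p r ((lam 0 i - i%:Z) - (mu 0 j - j%:Z) - 1) i j t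
  else PC_mx lam t i j.
Proof.
rewrite !mxE eqxx /=; case: eqP => _ /=.
  by apply: (congr1 (fun n => PC_entry p r n i j t)); ring.
by rewrite subr0.
Qed.

Lemma is_cderive_PC lam t :
  is_cderive (PC p r mu lam) t
    (- (\sum_(s < l) (p 0 s)%:C * PC p r mu lam t)
     + \sum_(s < l) (p 0 s)%:C * PC p r mu (lam - delta_mx 0 s) t).
Proof.
have hr : is_derive t 1 (PC_weight lam)
    (- (\sum_(s < l) p 0 s) * PC_weight lam t).
  rewrite /PC_weight; have he := is_derive_expRM (- \sum_(j < l) p 0 j) t.
  by apply: is_derive_eq; rewrite /GRing.scale /=; ring.
have hw : is_cderive (fun u => (PC_weight lam u)%:C) t
    (- (\sum_(s < l) p 0 s)%:C * (PC_weight lam t)%:C).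
  by rewrite -rmorphN -rmorphM; split=> //=; exact: is_derive_cst.
have hd : is_cderive (fun u => \det (PC_mx lam u)) t
    (\sum_(s < l) \det (PC_mx (lam - delta_mx 0 s) t)).
  (* The matrix of lam - eps_s is that of lam with row s replaced by its time derivative, as the
     determinant rule requires. *)
  under eq_bigr => s _.
    rewrite (_ : PC_mx _ t = \matrix_(i, j) if i == s then (\matrix_(i, j)
      PC_entry p r ((lam 0 i - i%:Z) - (mu 0 j - j%:Z) - 1) i j t) i j
      else PC_mx lam t i j); last first.
      by apply/matrixP => i j; rewrite PC_mx_subdelta !mxE.
    over.
  apply: is_cderive_det => i j; rewrite mxE.
  under eq_fun do rewrite mxE.
  exact: is_cderive_PC_entry.
(* All terms now share the weight of [lam], and the right-hand side takes the product-rule form: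
   weight' times det plus weight times det'. *)
rewrite (eq_bigr _ (fun s _ => PC_subdelta lam s t)) -mulr_sumr.
rewrite -mulr_suml -rmorph_sum PC_E mulrA -mulNr -mulNr.
rewrite (_ : PC p r mu lam =
    fun u => (PC_weight lam u)%:C * \det (PC_mx lam u)).
  exact: is_cderiveM.
by apply/funext => u; exact: PC_E.
Qed.

Lemma det_PC_mx_boundary lam (s s' : 'I_l) t :
  s' = s.+1 :> nat -> lam 0 s = lam 0 s' ->
  \det (PC_mx (lam - delta_mx 0 s) t) = (p 0 s')%:C * \det (PC_mx lam t).
Proof.
move=> ss' lss'.
apply: (@det_add_row _ _ _ _ s s').
- by rewrite -val_eqE /= ss' neq_ltn ltnSn.
- move=> j; rewrite PC_mx_subdelta eqxx.
  rewrite (PC_entry_boundary r_gt0 p_lt_r _ _ _ ss') !mxE lss'.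
  congr (_ + _); apply: (congr1 (fun n => PC_entry p r n s' j t)).
  (* Since s' = s + 1 and the parts agree, (lam_s - s) - 1 = lam_{s'} - s': the lowered exponent of
     row s is the unshifted exponent of row s'. *)
  by rewrite ss' -[s.+1]addn1 PoszD; ring.
- by move=> i j is_; rewrite PC_mx_subdelta (negbTE is_).
Qed.

End Generator.

Theorem theorem7p2 (R : realType) (l : nat) (p : 'rV[R]_l) (r : R)
    (mu : 'rV[int]_l) :
  (forall j, 0 < p 0 j) ->
  0 < r -> (forall k : 'I_l, (0 < k)%N -> `|p 0 k| < r) ->
  is_part mu ->
  forall (lam : 'rV[int]_l) (t : R), is_part lam -> 0 < t ->
  is_cderive (fun u => PC p r mu lam u) t
    (- (\sum_(s < l) (p 0 s)%:C * PC p r mu lam t)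
     + \sum_(s < l) (p 0 s)%:C * PC p r mu (lam - delta_mx 0 s) t)
  /\
  (forall s s' : 'I_l, s' = s.+1 :> nat -> lam 0 s = lam 0 s' ->
     (p 0 s)%:C * PC p r mu (lam - delta_mx 0 s) t
     = (p 0 s')%:C * PC p r mu lam t).
Proof.
move=> p0 r0 pr _ lam t _ _; split; first exact: is_cderive_PC.
move=> s s' ss' lss'.
by rewrite PC_subdelta// (det_PC_mx_boundary _ _ _ _ ss' lss')// PC_E mulrCA.
Qed.
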